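(* Let $t=\{t_k\}_{k=1}^\infty$ be a non-increasing sequence of positive numbers, let $n\in\mathbb{N}$, $1\le q<\infty$ and $0<p\le q$. If $\varepsilon\in[0,t_1]$, then $$\mathcal{E}\left(W^T_q,I^n_{\varepsilon,p}\right)=\mathcal{E}\left(W^T_q,I^n_{\varepsilon,p},\Phi^*_n\right)=\left(t_{n+1}^q+\varepsilon^q\left(1-\frac{t_{n+1}^q}{t_1^q}\right)\right)^{1/q},$$ and if $\varepsilon>t_1$, then $$\mathcal{E}\left(W^T_q,I^n_{\varepsilon,p}\right)=\mathcal{E}\left(W^T_q,I^n_{\varepsilon,p},\Phi^*_0\right)=t_1.$$
   Context: $\ell_q$ is the space of complex sequences $x=\{x_k\}_{k=1}^\infty$ with the usual norm $\|x\|_q$. The class is $W^T_q=\{x=Th : h\in\ell_q,\ \|h\|_q\le 1\}$, where $Th=\{t_kh_k\}_{k=1}^\infty$. Let $Z$ be a complex linear space, $W\subset\ell_q$, and let $I$ be an information mapping assigning to each $x\in\ell_q$ a non-empty subset $I(x)\subset Z$. A method of recovery is an arbitrary mapping $\Phi:Z\to\ell_q$. Its error is $\mathcal{E}(W,I,\Phi)=\sup_{x\in W}\sup_{a\in I(x)}\|x-\Phi(a)\|_q$, and the error of optimal recovery is $\mathcal{E}(W,I)=\inf_{\Phi}\mathcal{E}(W,I,\Phi)$, the infimum being over all methods $\Phi:Z\to\ell_q$. Here $Z=\mathbb{C}^n$ and $I^n_{\varepsilon,p}(x)=\{a\in\mathbb{C}^n:(\sum_{k=1}^n|x_k-a_k|^p)^{1/p}\le\varepsilon\}$.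 The methods are $$\Phi^*_n(a)=\left(a_1\Big(1-\frac{t_{n+1}^q}{t_1^q}\Big),\ldots,a_n\Big(1-\frac{t_{n+1}^q}{t_n^q}\Big),0,0,\ldots\right),$$ and $\Phi^*_0(a)$ is the zero sequence. *)

(* Defs.v *)
From HB Require Import structures.
From mathcomp Require Import all_boot all_order all_algebra.
From mathcomp Require Import all_classical all_reals all_analysis.
From mathcomp Require Import complex.
Set Implicit Arguments.
Unset Strict Implicit.
Unset Printing Implicit Defensive.
Import Order.TTheory GRing.Theory Num.Theory.
Import numFieldNormedType.Exports.
Local Open Scope classical_set_scope.
Local Open Scope ring_scope.

(* Sequences are indexed from 0 : the k-th term, k >= 1, of a sequence x of
   the literature is [x k.-1].  In particular t_1 is [t 0] and t_(n+1) is
   [t n]. *)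

Definition cmod (R : realType) (z : R[i]) : R := ComplexField.Normc.normc z.

Lemma cmod0 (R : realType) : cmod (0 : R[i]) = 0.
Proof. exact: ComplexField.Normc.normc0. Qed.

(* For q > 0 this is (\sum_k |x_k|^q)^(1/q), by Lnorm_counting. *)
Definition lqnorm (R : realType) (q : R) (x : nat -> R[i]) : \bar R :=
  Lnorm counting q%:E (fun k => (cmod (x k))%:E).

Record lq (R : realType) (q : R) := Lq {
  lq_seq :> nat -> R[i];
  lq_fin : (lqnorm q lq_seq < +oo)%E }.

Definition ext0 (R : realType) (n : nat) (a : 'rV[R[i]]_n) : nat -> R[i] :=
  fun k => oapp (a 0) 0 (insub k).

Lemma lqnorm_ext0_fin (R : realType) (q : R) (n : nat) (a : 'rV[R[i]]_n) :
  (lqnorm q (ext0 a) < +oo)%E.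
Proof.
rewrite /lqnorm unlock.
have [->|q0] := eqVneq q 0; first by rewrite invr0 poweRe0 ltry.
rewrite ge0_integral_count; last by move=> k; exact: poweR_ge0.
rewrite (@nneseries_split _ _ 0 n); last by move=> k _; exact: poweR_ge0.
rewrite add0n [X in (_ + X)%E]eseries0 ?adde0; last first.
  move=> k nk _; have -> : ext0 a k = 0 by rewrite /ext0 insubF// ltnNge nk.
  by rewrite cmod0 abse0 poweR_EFin powR0.
under eq_bigr => k _ do rewrite abse_EFin poweR_EFin.
by rewrite sumEFin poweR_EFin ltry.
Qed.

Definition lq_ext0 (R : realType) (q : R) (n : nat) (a : 'rV[R[i]]_n) : lq q :=
  Lq (lqnorm_ext0_fin q a).

Definition diag_op (R : realType) (t : nat -> R) (h : nat -> R[i]) :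
  nat -> R[i] := fun k => ((t k)%:C)%C * h k.

Definition classW (R : realType) (q : R) (t : nat -> R) : set (lq q) :=
  [set x | exists2 h : lq q, (lqnorm q h <= 1)%E & lq_seq x = diag_op t h].

Arguments classW {R} q t.

Definition rec_error (R : realType) (q : R) (Z : lmodType R[i])
    (W : set (lq q)) (I : lq q -> set Z) (Phi : Z -> lq q) : \bar R :=
  ereal_sup [set ereal_sup [set lqnorm q (fun k => x k - Phi a k) | a in I x]
            | x in W].

Definition opt_error (R : realType) (q : R) (Z : lmodType R[i])
    (W : set (lq q)) (I : lq q -> set Z) : \bar R :=
  ereal_inf [set rec_error W I Phi | Phi in [set: Z -> lq q]].

Definition info (R : realType) (q : R) (n : nat) (eps p : R) (x : lq q) :
  set 'rV[R[i]]_n :=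
  [set a | (\sum_(k < n) cmod (x k - a 0 k) `^ p) `^ p^-1 <= eps].

Arguments info {R q} n eps p x.

Lemma info_nonempty (R : realType) (q : R) (n : nat) (eps p : R) (x : lq q) :
  0 <= eps -> 0 < p -> info n eps p x !=set0.
Proof.
move=> e0 p0; exists (\row_k x k); rewrite /info /=.
rewrite big1 ?powR0 ?invr_neq0 ?gt_eqF// => k _.
by rewrite mxE subrr cmod0 powR0 ?gt_eqF.
Qed.

Definition Phi_star (R : realType) (q : R) (t : nat -> R) (n : nat)
    (a : 'rV[R[i]]_n) : lq q :=
  lq_ext0 q (\row_i (a 0 i * ((1 - t n `^ q / t i `^ q)%:C)%C)).

Arguments Phi_star {R} q t n a.

Definition Phi_zero (R : realType) (q : R) (n : nat) (a : 'rV[R[i]]_n) : lq q :=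
  lq_ext0 q (0 : 'rV[R[i]]_n).

Arguments Phi_zero {R} q n a.

(* Main.v *)
Require Import Defs.
From mathcomp Require Import all_boot all_order all_algebra.
From mathcomp Require Import all_classical all_reals all_analysis.
From mathcomp Require Import complex lra.

(** The error of a method is computed on both sides.

    From below: if the same information [a] is admissible for [x] and for [- x],
    both in the class, then [Phi a] misses one of them by at least [|x|_q]
    ([opt_error_ge_lqnorm]). Take [a = 0] and [x = T h] with [h] of norm one
    carried by the coordinates [0] and [n]: the first coordinate of [x] is [d],
    with [d <= eps] so that it is hidden by the noise, and [h n] uses up the
    rest of the unit ball. This gives
      [|x|_q `^ q = d `^ q + t n `^ q * (1 - d `^ q / t 0 `^ q)]
    ([opt_error_classW_ge]), where [d = eps] is the best choice as long as
    [eps <= t 0], and [d = t 0] beyond.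

    From above: the factor [1 - t n `^ q / t k `^ q] in the method makes its
    error in coordinate [k < n] a convex combination of [x k] and of the noise
    [x k - a k], with a weight on [x k] that turns [|x k| `^ q] into
    [t n `^ q * |h k| `^ q]. Convexity of the q-th power then separates the
    contribution of the class, at most [t n `^ q], from that of the noise, at
    most [eps `^ q * (1 - t n `^ q / t 0 `^ q)], the l_q norm of the noise being
    at most its l_p norm ([Phi_star_error_le]). For large noise the information
    is worthless and the zero method has error at most [t 0], the norm of [T]
    ([Phi_zero_error_le]). *)

Set Implicit Arguments.
Unset Strict Implicit.
Unset Printing Implicit Defensive.
Import Order.TTheory GRing.Theory Num.Theory.
Local Open Scope ring_scope.

(** * The modulus of complex numbers *)

Section Modulus.
Context {R : realType}.
Implicit Types z w : R[i].

Lemma cmod_ge0 z : 0 <= cmod z.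
Proof. by case: z => a b; exact: sqrtr_ge0. Qed.

Lemma cmodM z w : cmod (z * w) = cmod z * cmod w.
Proof. exact: ComplexField.Normc.normcM. Qed.

Lemma ler_cmodD z w : cmod (z + w) <= cmod z + cmod w.
Proof. exact: le_normcD. Qed.

Lemma cmodN z : cmod (- z) = cmod z.
Proof. exact: normcN. Qed.

Lemma cmodMn z m : cmod (z *+ m) = cmod z *+ m.
Proof. exact: normcMn. Qed.

Lemma cmodC (r : R) : cmod r%:C%C = `|r|.
Proof. by rewrite /cmod /= expr0n /= addr0 sqrtr_sqr. Qed.

End Modulus.

(** * Powers of nonnegative reals and finite sums *)

Section RealPowers.
Context {R : realType}.
Implicit Types q p s x y : R.

Lemma powRK_inv q x : 0 < q -> 0 <= x -> (x `^ q) `^ q^-1 = x.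
Proof. by move=> q0 x0; rewrite -powRrM divff ?gt_eqF// powRr1. Qed.

Lemma powRVK q x : 0 < q -> 0 <= x -> (x `^ q^-1) `^ q = x.
Proof. by move=> q0 x0; rewrite -powRrM mulVf ?gt_eqF// powRr1. Qed.

Lemma ler_powR_base q x y : 0 <= q -> 0 <= x -> x <= y -> x `^ q <= y `^ q.
Proof.
move=> q0 x0 xy; apply: ge0_ler_powR => //; rewrite nnegrE//.
exact: le_trans xy.
Qed.

Lemma powR_convex_comb q s x y : 1 <= q -> 0 <= s <= 1 -> 0 <= x -> 0 <= y ->
  (s * x + (1 - s) * y) `^ q <= s * x `^ q + (1 - s) * y `^ q.
Proof.
move=> q1 /andP[s0 s1] x0 y0.
by apply: (convex_powR q1 (Itv01 s0 s1)); rewrite inE/= in_itv/= andbT.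
Qed.

(** The l_p quasi-norm dominates the l_q norm for [p <= q]: all entries are at
    most [e], so [u k `^ q <= u k `^ p * e `^ (q - p)]. *)
Lemma sum_powR_le_exponent m (u : 'I_m -> R) p q e :
    0 < p -> p <= q -> 0 <= e -> (forall k, 0 <= u k) ->
  (\sum_(k < m) u k `^ p) `^ p^-1 <= e -> \sum_(k < m) u k `^ q <= e `^ q.
Proof.
move=> p0 pq e0 u0 ue.
have sum0 : 0 <= \sum_(k < m) u k `^ p.
  by apply: sumr_ge0 => k _; exact: powR_ge0.
have sume : \sum_(k < m) u k `^ p <= e `^ p.
  rewrite -[leLHS](powRVK p0)//.
  by apply: ler_powR_base; rewrite ?powR_ge0 ?(ltW p0).
have split x : x `^ q = x `^ p * x `^ (q - p).
  rewrite -powRD; first by rewrite addrC subrK.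
  by rewrite addrC subrK gt_eqF// (lt_le_trans p0).
have uke k : u k <= e.
  rewrite -(powRK_inv p0 (u0 k)) (le_trans _ ue)//.
  apply: ler_powR_base; rewrite ?powR_ge0 ?invr_ge0 ?(ltW p0)//.
  rewrite (bigD1 k)//= lerDl; apply: sumr_ge0 => i _; exact: powR_ge0.
rewrite split; apply: (@le_trans _ _ (\sum_(k < m) u k `^ p * e `^ (q - p))).
  apply: ler_sum => k _; rewrite split ler_wpM2l ?powR_ge0//.
  by apply: ler_powR_base; rewrite ?subr_ge0.
by rewrite -mulr_suml ler_wpM2r ?powR_ge0.
Qed.

Lemma sum_ends n (F : nat -> R) : (0 < n)%N ->
  (forall k, (0 < k < n)%N -> F k = 0) -> \sum_(k < n.+1) F k = F 0%N + F n.
Proof.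
case: n => // m _ F0; rewrite big_ord_recr big_ord_recl/= big1 ?addr0// => k _.
by apply: F0; rewrite /= ltnS ltn_ord.
Qed.

(** Stated for arbitrary [n] and [N], so that the terms of index below
    [n] are controlled in every partial sum, even those of length [N < n]. *)
Lemma sum_trunc_le n N (F : nat -> R) : (forall k, 0 <= F k) ->
  \sum_(k < N) (if (k < n)%N then F k else 0) <= \sum_(k < n) F k.
Proof.
move=> F0; rewrite -big_mkcond/=.
rewrite -(big_mkord (fun k => k < n)%N F) -(big_mkord xpredT F).
rewrite (big_nat_widen _ _ _ _ _ (leq_maxl n N)).
rewrite [leRHS](big_cat_nat (n := N))//= ?leq_maxr// lerDl.
by apply: sumr_ge0.
Qed.

End RealPowers.

(** * The l_q norm through partial sums *)

Section LqNorm.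
Context {R : realType}.
Implicit Types (q c : R) (x : nat -> R[i]).

Lemma lqnorm_ge0 q x : (0 <= lqnorm q x)%E.
Proof. exact: Lnorm_ge0. Qed.

(** Reduces estimates of the extended-real norm of an infinite sequence to
    inequalities between finite sums of real numbers. *)
Lemma lqnorm_leP q c x : 0 < q -> 0 <= c ->
  (lqnorm q x <= c%:E)%E <->
  (forall N, \sum_(k < N) cmod (x k) `^ q <= c `^ q).
Proof.
move=> q0 c0; rewrite /lqnorm Lnorm_counting//.
under eq_eseriesr do
  rewrite abse_EFin ger0_norm ?cmod_ge0// poweR_EFin.
set S := (\sum_(0 <= k <oo) _)%E.
have S0 : (0 <= S)%E by apply: nneseries_ge0 => k _ _; rewrite lee_fin powR_ge0.
have -> : (S `^ q^-1 <= c%:E)%E <-> (S <= (c `^ q)%:E)%E.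
  rewrite -poweR_EFin; split => [Sc|Sc].
    have -> : S = ((S `^ q^-1) `^ q)%E.
      by rewrite -poweRrM mulVf ?gt_eqF// poweRe1.
    apply: gt0_ler_poweR; rewrite ?(ltW q0)// in_itv/= leey andbT;
    by rewrite ?poweR_ge0 ?lee_fin ?powR_ge0.
  have -> : c%:E = ((c%:E `^ q) `^ q^-1)%E.
    by rewrite -poweRrM divff ?gt_eqF// poweRe1.
  apply: gt0_ler_poweR; rewrite ?invr_ge0 ?(ltW q0)// in_itv/= leey andbT;
    by rewrite ?poweR_ge0 ?lee_fin ?powR_ge0.
split => [Sc N|Nc].
  rewrite -lee_fin (le_trans _ Sc)// -sumEFin.
  have := @nneseries_lim_ge R (fun k => (cmod (x k) `^ q)%:E) xpredT 0 N.
  by rewrite big_mkord; apply => k _ _; rewrite lee_fin powR_ge0.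
apply: lime_le.
  by apply: is_cvg_nneseries => k _ _; rewrite lee_fin powR_ge0.
by apply: nearW => N; rewrite sumEFin lee_fin big_mkord.
Qed.

Lemma ext0_lt n (a : 'rV[R[i]]_n) k (kn : (k < n)%N) :
  ext0 a k = a 0 (Ordinal kn).
Proof. by rewrite /ext0 insubT. Qed.

Lemma ext0_ge n (a : 'rV[R[i]]_n) k : (n <= k)%N -> ext0 a k = 0.
Proof. by move=> nk; rewrite /ext0 insubF// ltnNge nk. Qed.

Lemma ext0N n (a : 'rV[R[i]]_n) k : ext0 (- a) k = - ext0 a k.
Proof.
have [kn|nk] := ltnP k n; last by rewrite !ext0_ge// oppr0.
by rewrite !(ext0_lt _ kn) mxE.
Qed.

Lemma lqnorm_ext0 q n (a : 'rV[R[i]]_n) : 0 < q ->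
  lqnorm q (ext0 a) = ((\sum_(k < n) cmod (a 0 k) `^ q) `^ q^-1)%:E.
Proof.
move=> q0; rewrite /lqnorm Lnorm_counting// -poweR_EFin; congr (_ `^ _)%E.
rewrite (@nneseries_split _ _ 0 n); last by move=> k _; exact: poweR_ge0.
rewrite add0n [X in (_ + X)%E]eseries0 ?adde0; last first.
  by move=> k nk _; rewrite ext0_ge// cmod0 abse0 poweR_EFin powR0 ?gt_eqF.
rewrite big_mkord -sumEFin; apply: eq_bigr => k _.
rewrite abse_EFin ger0_norm ?cmod_ge0// poweR_EFin (ext0_lt _ (ltn_ord k)).
by congr (cmod (a 0 _) `^ _)%:E; exact: val_inj.
Qed.

End LqNorm.

(** * Bounds for the error of recovery *)

Section Recovery.
Context {R : realType}.
Implicit Types q r : R.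

(** Since [2 x = (x - y) - (- x - y)], convexity of [z |-> z `^ q] bounds
    [|x_k| `^ q] by the mean of [|x_k - y_k| `^ q] and [|- x_k - y_k| `^ q]. *)
Lemma lqnorm_le_max_sym q r (x y : nat -> R[i]) : 1 <= q -> 0 <= r ->
  (lqnorm q (fun k => (x k - y k)%R) <= r%:E)%E ->
  (lqnorm q (fun k => (- x k - y k)%R) <= r%:E)%E ->
  (lqnorm q x <= r%:E)%E.
Proof.
move=> q1 r0; have q0 : 0 < q by exact: lt_le_trans q1.
move=> /(lqnorm_leP _ q0 r0) xy /(lqnorm_leP _ q0 r0) xNy.
apply/(lqnorm_leP _ q0 r0) => N; move: (xy N) (xNy N).
set A := \sum_(k < N) _ => Ar; set B := \sum_(k < N) _ => Br.
apply: (@le_trans _ _ (2^-1 * A + (1 - 2^-1) * B)); last by lra.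
rewrite !mulr_sumr -big_split/=; apply: ler_sum => k _.
apply: le_trans (powR_convex_comb q1 _ (cmod_ge0 _) (cmod_ge0 _)); last by lra.
apply: ler_powR_base; rewrite ?(ltW q0) ?cmod_ge0//.
have := ler_cmodD (x k - y k) (- (- x k - y k)).
rewrite cmodN opprD !opprK addrACA addNr addr0 -mulr2n cmodMn.
lra.
Qed.

(** Information shared by [x] and [- x] cannot tell them apart: any method
    answers both with the same [Phi a], which is at distance at least [|x|_q]
    from one of the two. *)
Lemma opt_error_ge_lqnorm q (Z : lmodType R[i]) (W : set (lq q))
    (I : lq q -> set Z) (x y : lq q) (a : Z) : 1 <= q ->
  W x -> W y -> I x a -> I y a -> (forall k, y k = - x k) ->
  (lqnorm q x <= opt_error W I)%E.
Proof.
move=> q1 Wx Wy Ixa Iya yx; apply/ereal_infP => _ [Phi _ <-].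
have err_le z : W z -> I z a ->
    (lqnorm q (fun k => (z k - Phi a k)%R) <= rec_error W I Phi)%E.
  move=> Wz Iza; apply: le_ereal_sup_tmp; eexists; first by exists z.
  by apply: ereal_sup_ubound; exists a.
have := err_le _ Wx Ixa; have := err_le _ Wy Iya.
rewrite (_ : (fun k => y k - _) = (fun k => - x k - Phi a k)); last first.
  by apply/funext => k; rewrite yx.
case: (rec_error W I Phi) => [r| |] yr xr.
- have r0 : 0 <= r by rewrite -lee_fin (le_trans _ xr)// lqnorm_ge0.
  exact: lqnorm_le_max_sym xr yr.
- by rewrite leey.
- by have := le_trans (lqnorm_ge0 _ _) xr.
Qed.

Lemma rec_error_le q (Z : lmodType R[i]) (W : set (lq q)) (I : lq q -> set Z)
    (Phi : Z -> lq q) (c : \bar R) :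
  (forall x a, W x -> I x a ->
     (lqnorm q (fun k => (x k - Phi a k)%R) <= c)%E) ->
  (rec_error W I Phi <= c)%E.
Proof.
move=> xc; apply/ereal_supP => _ [x Wx <-]; apply/ereal_supP => _ [a Ia <-].
exact: xc.
Qed.

Lemma opt_error_le q (Z : lmodType R[i]) (W : set (lq q)) (I : lq q -> set Z)
    (Phi : Z -> lq q) : (opt_error W I <= rec_error W I Phi)%E.
Proof. by apply: ereal_inf_lbound; exists Phi. Qed.

End Recovery.

(** * The image of the unit ball under a diagonal operator *)

Section DiagonalClass.
Context {R : realType}.
Variables (t : nat -> R) (n : nat) (q p : R).
Hypotheses (t_gt0 : forall k : nat, 0 < t k) (t_noninc : nonincreasing_seq t).
Hypotheses (q_ge1 : 1 <= q) (p_gt0 : 0 < p) (p_leq : p <= q).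

Let q_gt0 : 0 < q. Proof. exact: lt_le_trans q_ge1. Qed.

Let t_powR_le i j : (i <= j)%N -> t j `^ q <= t i `^ q.
Proof.
move=> ij; apply: ler_powR_base; [exact: ltW|exact: ltW|exact: t_noninc].
Qed.

Lemma classW_ext0 m (h : 'rV[R[i]]_m) : (lqnorm q (ext0 h) <= 1)%E ->
  classW q t (lq_ext0 q (\row_k ((t k)%:C%C * h 0 k))).
Proof.
move=> h1; exists (lq_ext0 q h) => //=; apply/funext => k.
rewrite /diag_op/=; have [km|mk] := ltnP k m.
  by rewrite !(ext0_lt _ km) mxE.
by rewrite !ext0_ge// mulr0.
Qed.

(** The extremal element has the first and the (n+1)-st coordinates only: the
    first is [d], invisible at accuracy [e], which costs [(d / t 0) `^ q] of the
    unit budget for [h]; the rest goes to the first unobserved coordinate.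
    Keeping [d] apart from [e] covers both small and large noise. *)
Lemma opt_error_classW_ge (d e : R) :
  (0 < n)%N -> 0 <= d -> d <= t 0%N -> d <= e ->
  (((t n `^ q + d `^ q * (1 - t n `^ q / t 0%N `^ q)) `^ q^-1)%:E
     <= opt_error (classW q t) (info n e p))%E.
Proof.
move=> n0 d0 dt de.
pose s := d / t 0%N.
have s01 : 0 <= s <= 1 by rewrite divr_ge0 ?ler_pdivrMr ?mul1r ?(ltW (t_gt0 _)).
have sq1 : s `^ q <= 1.
  rewrite (_ : 1 = 1 `^ q); last by rewrite powR1.
  case/andP: s01 => s0 s1.
  by apply: ler_powR_base; rewrite ?(ltW q_gt0).
pose r k : R := if k == 0%N then s else
                if k == n then (1 - s `^ q) `^ q^-1 else 0.
have r0 k : 0 <= r k.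
  rewrite /r; case: ifP => _; first by case/andP: s01.
  by case: ifP; rewrite ?powR_ge0.
have rmid k : (0 < k < n)%N -> r k = 0.
  by move=> /andP[k0 kn]; rewrite /r gtn_eqF// ltn_eqF.
have rnq : r n `^ q = 1 - s `^ q.
  by rewrite /r gtn_eqF// eqxx powRVK// subr_ge0.
have t0r0 : t 0%N * r 0%N = d by rewrite /r eqxx mulrC divfK ?gt_eqF.
pose h : 'rV[R[i]]_n.+1 := \row_k (r k)%:C%C.
pose X (g : 'rV[R[i]]_n.+1) := \row_k ((t k)%:C%C * g 0 k).
(* Both [h] and [- h] have to be followed, since the information zero must be
   admissible for [x] and for [- x]. *)
have hN1 g : g = h \/ g = - h -> (lqnorm q (ext0 g) <= 1)%E.
  move=> gh; rewrite lqnorm_ext0//.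
  rewrite (eq_bigr (fun k : 'I_n.+1 => r k `^ q)); last first.
    by move=> k _; case: gh => ->; rewrite !mxE ?cmodN cmodC ger0_norm.
  rewrite (sum_ends (F := fun k => r k `^ q))//; last first.
    by move=> k k0n; rewrite rmid// powR0 ?gt_eqF.
  by rewrite rnq /r eqxx addrC subrK powR1.
have XN : X (- h) = - X h by apply/rowP => k; rewrite !mxE mulrN.
have infoX g : g = h \/ g = - h -> info n e p (lq_ext0 q (X g)) 0.
  move=> gh; rewrite /info/=.
  rewrite (eq_bigr (fun k : 'I_n => (t k * r k) `^ p)); last first.
    move=> k _; have kn : (k < n.+1)%N by rewrite ltnS ltnW.
    rewrite !(ext0_lt _ kn) !mxE subr0.
    by case: gh => ->; rewrite !mxE ?mulrN ?cmodN cmodM !cmodC !ger0_norm// ltW.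
  case: (n) n0 rmid => // m _ rmid.
  rewrite big_ord_recl big1 ?addr0; last first.
    move=> k _; rewrite rmid ?mulr0 ?powR0 ?gt_eqF//.
    by rewrite /= ltnS ltn_ord.
  by rewrite [t _ * r _]t0r0 powRK_inv.
have ymx k : lq_ext0 q (X (- h)) k = - lq_ext0 q (X h) k by rewrite XN /= ext0N.
have hh : h = h \/ h = - h by left.
have Nhh : - h = h \/ - h = - h by right.
apply: le_trans (opt_error_ge_lqnorm q_ge1 (classW_ext0 (hN1 _ hh))
  (classW_ext0 (hN1 _ Nhh)) (infoX _ hh) (infoX _ Nhh) ymx).
rewrite /= lqnorm_ext0// lee_fin.
rewrite (eq_bigr (fun k : 'I_n.+1 => (t k * r k) `^ q)); last first.
  by move=> k _; rewrite !mxE cmodM !cmodC !ger0_norm// ltW.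
rewrite (sum_ends (F := fun k => (t k * r k) `^ q))//; last first.
  by move=> k k0n; rewrite rmid// mulr0 powR0 ?gt_eqF.
rewrite t0r0 (powRM _ (ltW (t_gt0 n)))// rnq.
suff -> : s `^ q = d `^ q / t 0%N `^ q.
  rewrite le_eqVlt; apply/orP; left; apply/eqP; congr (_ `^ _); lra.
rewrite powRM ?invr_ge0 ?(ltW (t_gt0 _))// -powR_inv1 ?(ltW (t_gt0 _))//.
by rewrite -powRrM mulN1r powRN.
Qed.

(** With [s k = t n `^ q / t k `^ q], the error in an observed coordinate is the
    convex combination [s k * x k + (1 - s k) * (x k - a k)]. Its first part
    contributes [s k * |x k| `^ q = t n `^ q * |h k| `^ q], exactly what the
    unobserved coordinates are bounded by, so that the sum over all [k] is at
    most [t n `^ q]; the weight [1 - s k] of the noise is largest at [k = 0]. *)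
Lemma Phi_star_error_le (e : R) : 0 <= e ->
  (rec_error (classW q t) (info n e p) (Phi_star q t n)
     <= ((t n `^ q + e `^ q * (1 - t n `^ q / t 0%N `^ q)) `^ q^-1)%:E)%E.
Proof.
move=> e0; apply: rec_error_le => x a [h h1 xh] Ixa.
pose s k := t n `^ q / t k `^ q.
have s0 k : 0 <= s k by rewrite divr_ge0// powR_ge0.
have s1 k : (k <= n)%N -> s k <= 1.
  move=> kn; rewrite ler_pdivrMr ?powR_gt0// mul1r.
  exact: t_powR_le.
have s0_min k : s 0%N <= s k.
  rewrite ler_wpM2l ?powR_ge0// lef_pV2 ?posrE ?powR_gt0//.
  exact: t_powR_le.
have xE k : x k = (t k)%:C%C * h k by rewrite xh.
pose F k := (1 - s 0%N) * cmod (x k - ext0 a k) `^ q.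
have F0 k : 0 <= F k by rewrite mulr_ge0 ?powR_ge0// subr_ge0 s1.
have term k : cmod (x k - Phi_star q t n a k) `^ q <=
    t n `^ q * cmod (h k) `^ q + (if (k < n)%N then F k else 0).
  have [kn|nk] := ltnP k n; last first.
    rewrite /= ext0_ge// subr0 xE cmodM cmodC ger0_norm ?(ltW (t_gt0 _))//.
    rewrite powRM ?cmod_ge0 ?(ltW (t_gt0 _))// addr0 ler_wpM2r ?powR_ge0//.
    exact: t_powR_le.
  have -> : t n `^ q * cmod (h k) `^ q = s k * cmod (x k) `^ q.
    rewrite xE cmodM cmodC ger0_norm ?(ltW (t_gt0 _))//.
    by rewrite powRM ?cmod_ge0 ?(ltW (t_gt0 _))// mulrA divfK ?gt_eqF ?powR_gt0.
  apply: (@le_trans _ _ (s k * cmod (x k) `^ q +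
                         (1 - s k) * cmod (x k - ext0 a k) `^ q)); last first.
    by rewrite lerD2l /F ler_wpM2r ?powR_ge0// lerB.
  have sk : 0 <= s k <= 1 by rewrite s0 s1// ltnW.
  apply: le_trans (powR_convex_comb q_ge1 sk (cmod_ge0 _) (cmod_ge0 _)).
  have sk' : 0 <= 1 - s k by rewrite subr_ge0 s1// ltnW.
  apply: ler_powR_base; rewrite ?(ltW q_gt0) ?cmod_ge0//.
  have -> : x k - Phi_star q t n a k =
      (s k)%:C%C * x k + (1 - s k)%:C%C * (x k - ext0 a k).
    rewrite /= !(ext0_lt _ kn) mxE /= -/(s k) mulrBr addrA -mulrDl -rmorphD/=.
    by rewrite [s k + _]addrC subrK rmorph1 mul1r [a _ _ * _]mulrC.
  apply: le_trans (ler_cmodD _ _) _.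
  by rewrite !cmodM !cmodC !ger0_norm.
apply/lqnorm_leP => [//||N]; first exact: powR_ge0.
rewrite powRVK//; last first.
  by rewrite addr_ge0 ?mulr_ge0 ?powR_ge0// subr_ge0 s1.
apply: le_trans; first by apply: ler_sum => k _; exact: term.
rewrite big_split/= -mulr_sumr lerD//.
  rewrite -[leRHS]mulr1 ler_wpM2l ?powR_ge0//.
  by move/lqnorm_leP : h1 => /(_ q_gt0 ler01 N); rewrite powR1.
apply: le_trans (sum_trunc_le n N F0) _.
rewrite -mulr_sumr mulrC ler_wpM2r ?subr_ge0 ?s1//.
rewrite (eq_bigr (fun k : 'I_n => cmod (x k - a 0 k) `^ q)); last first.
  move=> k _; rewrite (ext0_lt _ (ltn_ord k)).
  by congr (cmod (x k - a 0 _) `^ _); exact: val_inj.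
by apply: sum_powR_le_exponent Ixa => // k; exact: cmod_ge0.
Qed.

Lemma Phi_zero_error_le (e : R) :
  (rec_error (classW q t) (info n e p) (Phi_zero q n) <= (t 0%N)%:E)%E.
Proof.
have t0 := ltW (t_gt0 0%N).
apply: rec_error_le => x a [h h1 xh] _.
apply/lqnorm_leP => // N.
move/lqnorm_leP : h1 => /(_ q_gt0 ler01 N); rewrite powR1 => h1.
rewrite -[leRHS]mulr1; apply: le_trans (ler_wpM2l (powR_ge0 _ _) h1).
rewrite mulr_sumr; apply: ler_sum => k _.
have -> : Phi_zero q n a k = 0.
  have [kn|nk] := ltnP k n; last exact: ext0_ge.
  by rewrite /= (ext0_lt _ kn) mxE.
rewrite subr0 xh cmodM cmodC ger0_norm ?(ltW (t_gt0 _))//.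
rewrite powRM ?cmod_ge0 ?(ltW (t_gt0 _))// ler_wpM2r ?powR_ge0//.
exact: t_powR_le.
Qed.

End DiagonalClass.

Theorem theorem3 (R : realType) (t : nat -> R) (n : nat) (q p eps : R)
    (t_gt0 : forall k : nat, 0 < t k) (t_noninc : nonincreasing_seq t)
    (n_gt0 : (0 < n)%N) (q_ge1 : 1 <= q) (p_gt0 : 0 < p) (p_leq : p <= q) :
  (0 <= eps <= t 0%N ->
     opt_error (classW q t) (info n eps p)
       = rec_error (classW q t) (info n eps p) (Phi_star q t n)
     /\ rec_error (classW q t) (info n eps p) (Phi_star q t n)
       = ((t n `^ q + eps `^ q * (1 - t n `^ q / t 0%N `^ q)) `^ q^-1)%:E)
  /\
  (t 0%N < eps ->
     opt_error (classW q t) (info n eps p)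
       = rec_error (classW q t) (info n eps p) (Phi_zero q n)
     /\ rec_error (classW q t) (info n eps p) (Phi_zero q n)
       = (t 0%N)%:E).
Proof.
have squeeze (o r c : \bar R) :
    (o <= r -> r <= c -> c <= o -> o = r /\ r = c)%E.
  move=> o_r r_c c_o; split; apply/le_anti/andP; split=> //.
    exact: le_trans r_c c_o.
  exact: le_trans c_o o_r.
split=> [/andP[eps0 epst]|teps]; apply: squeeze (opt_error_le _ _ _) _ _.
- exact: Phi_star_error_le.
- exact: opt_error_classW_ge.
- exact: Phi_zero_error_le.
have t0 := ltW (t_gt0 0%N); have q0 : 0 < q by exact: lt_le_trans q_ge1.
(* Above accuracy [t 0] the first coordinate of the extremal element is capped
   at [t 0], where it takes up the whole budget; the bound becomes [t 0]. *)
have := @opt_error_classW_ge R t n q p t_gt0 q_ge1 p_gt0 (t 0%N) eps n_gt0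
  t0 (lexx _) (ltW teps).
rewrite mulrBr mulr1 mulrCA divff ?gt_eqF ?powR_gt0// mulr1 addrC subrK.
by rewrite powRK_inv.
Qed.
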